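(* Let $\mathcal{X}=(X,d_X,f_X)$ be a finite augmented metric space and fix any total order $<$ on $X$ compatible with $f_X$. Assume that for each $x\in X$ there exists a constant $<$-conqueror function $c_x$. Then $\mathrm{H}_0(\mathcal{R}^{\mathrm{bi}}_\bullet(\mathcal{X})):\mathbb{R}^2\to\mathbf{Vec}$ is interval decomposable and its barcode coincides with the elder-rule-staircode $\mathcal{I}_{\mathcal{X}}^<=\{\!\{I_x^<:x\in X\}\!\}$.
   Context: **Augmented metric spaces and Rips bifiltration.** A finite augmented metric space is a triple $\mathcal{X}=(X,d_X,f_X)$ with $(X,d_X)$ a finite metric space and $f_X:X\to\mathbb{R}$. Put $X_\sigma=\{x\in X: f_X(x)\le\sigma\}$. $\mathcal{R}_\varepsilon(X_\sigma,d_X)$ is the simplicial complex whose simplices are the nonempty $A\subseteq X_\sigma$ with $d_X(a,a')\le\varepsilon$ for all $a,a'\in A$ (empty if $\varepsilon<0$). The Rips bifiltration $\mathcal{R}^{\mathrm{bi}}_\bullet(\mathcal{X})$ is the functor on $\mathbb{R}^2$ (product order) sending $(\sigma,\varepsilon)$ to $\mathcal{R}_\varepsilon(X_\sigma,d_X)$, with inclusions as internal maps. $\mathrm{H}_0$ is simplicial homology with coefficients in a fixed field $\mathbb{F}$; $\mathbf{Vec}$ is the category of finite-dimensional $\mathbb{F}$-vector spaces. **Elder-rule-staircode.** For $\varepsilon\ge 0$ and $x\in X_\sigma$, $[x]_{(\sigma,\varepsilon)}$ is the set of all $x'\in X_\sigma$ joined to $x$ by a sequence in $X_\sigma$ with consecutive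 distances $\le\varepsilon$. A total order $<$ on $X$ is compatible with $f_X$ if $f_X(x)<f_X(x')$ implies $x<x'$. $I_x^<:=\{(\sigma,\varepsilon)\in\mathbb{R}^2:\varepsilon\ge0,\ x\in X_\sigma,\ x=\min([x]_{(\sigma,\varepsilon)},<)\}$. **Conquerors.** For a finite metric space $(Y,d)$ and $y,y'\in Y$, let $u_Y(y,y')$ be the minimal $\varepsilon\ge0$ such that there is a sequence in $Y$ from $y$ to $y'$ with consecutive distances $\le\varepsilon$. Given a total order $<$ on $Y$ and a non-minimal $y\in Y$, a $<$-conqueror of $y$ in $(Y,d)$ is an element $y'<y$ such that $u_Y(y,y')\le u_Y(y,y'')$ for all $y''\in Y$ with $y''<y$. For a non-minimal $x\in(X,<)$, a $<$-conqueror function $c_x:[f_X(x),\infty)\to X$ is a function sending each $\sigma$ to a $<$-conqueror of $x$ in $(X_\sigma,d_X)$. For the minimum $x'$ of $(X,<)$, $c_{x'}$ is defined to be the constant function at $x'$. **Interval decomposability.** For a poset $\mathbb{P}$, an interval $\mathcal{J}\subseteq\mathbb{P}$ is a nonempty, convex ($a,b\in\mathcal{J}$, $a\le c\le b$ imply $c\in\mathcal{J}$) subset in which any two elements are joined by a finite sequence of elements of $\mathcal{J}$ with consecutive elements comparable. The interval module $I^{\mathcal{J}}$ is $\mathbb{F}$ on $\mathcal{J}$ with identity internal maps within $\mathcal{J}$, and $0$ elsewhere. A functor $N:\mathbb{P}\to\mathbf{Vec}$ is interval decomposable if $N\cong\bigoplus_{\mathcal{J}\in B}I^{\mathcal{J}}$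 for some multiset $B$ of intervals; $B$ is then unique and is called the barcode of $N$. *)

(* Defs.v *)
From HB Require Import structures.
From mathcomp Require Import all_boot all_order all_algebra.
From mathcomp Require Import generic_quotient ring_quotient.
From mathcomp Require Import mathcomp_extra boolp classical_sets functions.
From mathcomp Require Import cardinality reals.

Set Implicit Arguments.
Unset Strict Implicit.
Unset Printing Implicit Defensive.

Import Order.TTheory GRing.Theory Num.Theory.

Local Open Scope ring_scope.

(** * Quotient of a finite-dimensional vector space by a subspace *)

Section QuotientSpace.
Variables (F : fieldType) (V : vectType F) (U : {vspace V}).

Definition vquot : Type := Quotient.quot (pred_of_vspace U).

HB.instance Definition _ := GRing.Zmodule.on vquot.

Definition vquot_pi (v : V) : vquot :=
  \pi_(Quotient.quot (pred_of_vspace U))%qT v.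
Definition vquot_repr (x : vquot) : V :=
  @repr _ (Quotient.quot (pred_of_vspace U)) x.

Lemma vquot_reprK : cancel vquot_repr vquot_pi.
Proof. by move=> x; rewrite /vquot_pi /vquot_repr reprK. Qed.

Lemma vquot_eqP v w : vquot_pi v = vquot_pi w <-> v - w \in U.
Proof.
have -> : (v - w \in U) =
    (v == w %[mod Quotient.quot (pred_of_vspace U)])%qT.
  exact: (Quotient.idealrBE (pred_of_vspace U) v w).
by split=> [H|/eqP]; first apply/eqP.
Qed.

Lemma vquot_piD : {morph vquot_pi : v w / v + w}.
Proof. exact: (Quotient.pi_add (pred_of_vspace U)). Qed.

Definition vquot_scale (a : F) (x : vquot) : vquot :=
  vquot_pi (a *: vquot_repr x).

Lemma vquot_repr_pi v : vquot_repr (vquot_pi v) - v \in U.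
Proof. by apply/vquot_eqP; rewrite vquot_reprK. Qed.

Lemma vquot_piZ a v : vquot_pi (a *: v) = vquot_scale a (vquot_pi v).
Proof.
rewrite /vquot_scale; apply/vquot_eqP.
by rewrite -scalerBr rpredZ // -opprB rpredN vquot_repr_pi.
Qed.

Fact vquot_scaleA a b x :
  vquot_scale a (vquot_scale b x) = vquot_scale (a * b) x.
Proof. by rewrite -(vquot_reprK x) -!vquot_piZ scalerA. Qed.

Fact vquot_scale1 : left_id 1 vquot_scale.
Proof. by move=> x; rewrite -(vquot_reprK x) -!vquot_piZ scale1r. Qed.

Fact vquot_scaleDr : right_distributive vquot_scale +%R.
Proof.
move=> a x y; rewrite -(vquot_reprK x) -(vquot_reprK y).
by rewrite -!(vquot_piZ, vquot_piD) scalerDr.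
Qed.

Fact vquot_scaleDl x : {morph vquot_scale^~ x : a b / a + b}.
Proof.
move=> a b; rewrite -(vquot_reprK x).
by rewrite -!(vquot_piZ, vquot_piD) scalerDl.
Qed.

HB.instance Definition _ := GRing.Zmodule_isLmodule.Build F vquot
  vquot_scaleA vquot_scale1 vquot_scaleDr vquot_scaleDl.

Fact vquot_pi_linear : linear vquot_pi.
Proof. by move=> a v w; rewrite vquot_piD vquot_piZ. Qed.

HB.instance Definition _ :=
  GRing.isLinear.Build F V vquot _ vquot_pi vquot_pi_linear.

Fact vquot_vect_iso : Vector.axiom (\dim U^C) vquot.
Proof.
have UC0 : (U^C :&: U = 0)%VS by rewrite capvC capv_compl.
have kill u : u \in U -> daddv_pi U^C U u = 0.
  move=> uU; have := @daddv_pi_add _ _ U^C U u UC0.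
  rewrite addvC addv_complf memvf => /(_ isT).
  rewrite (@daddv_pi_id _ _ U U^C u) ?capv_compl // => /eqP.
  by rewrite -subr_eq0 addrK => /eqP.
pose f (x : vquot) : subvs_of U^C := vsproj U^C (daddv_pi U^C U (vquot_repr x)).
have f_pi v : f (vquot_pi v) = vsproj U^C (daddv_pi U^C U v).
  apply/eqP; rewrite -subr_eq0 /f -!linearB /=.
  by rewrite kill ?linear0 ?vquot_repr_pi.
have f_lin : linear f.
  move=> a x y; rewrite -(vquot_reprK x) -(vquot_reprK y) -linearP.
  by rewrite !f_pi !linearP.
have f_bij : bijective f.
  exists (fun w => vquot_pi (vsval w)) => [x|w]; last first.
    by rewrite f_pi daddv_pi_id ?subvsP // vsvalK.
  rewrite -[RHS]vquot_reprK /f vsprojK ?memv_pi //; apply/vquot_eqP.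
  set v := vquot_repr x; have := @daddv_pi_add _ _ U^C U v UC0.
  rewrite addvC addv_complf memvf => /(_ isT) e.
  by rewrite -[X in _ - X]e opprD addNKr rpredN memv_pi.
have [g gl gb] : Vector.axiom (\dim U^C) (subvs_of U^C) by exact: subvs_vect_iso.
exists (g \o f); last exact: bij_comp.
by move=> a x y /=; rewrite f_lin gl.
Qed.

HB.instance Definition _ := Lmodule_hasFinDim.Build F vquot vquot_vect_iso.

End QuotientSpace.

Section QuotientMap.
Variables (F : fieldType) (V W : vectType F) (f : {linear V -> W}).
Variables (U : {vspace V}) (U' : {vspace W}).
Hypothesis fU : forall u, u \in U -> f u \in U'.

Definition vquot_map of (forall u, u \in U -> f u \in U') :
  vquot U -> vquot U' := fun x => vquot_pi U' (f (vquot_repr x)).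

Lemma vquot_mapE v : vquot_map fU (vquot_pi U v) = vquot_pi U' (f v).
Proof. by apply/vquot_eqP; rewrite -linearB fU // vquot_repr_pi. Qed.

Fact vquot_map_linear : linear (vquot_map fU).
Proof.
move=> a x y; rewrite -(vquot_reprK x) -(vquot_reprK y) -linearP.
by rewrite !vquot_mapE !linearP.
Qed.

HB.instance Definition _ := GRing.isLinear.Build F (vquot U) (vquot U') _
  (vquot_map fU) vquot_map_linear.

End QuotientMap.

(** * Persistence modules over a poset *)

Section Modules.
Variables (F : fieldType) (d : Order.disp_t) (P : porderType d).
Local Open Scope order_scope.

Definition functor_laws (V : P -> lmodType F)
    (phi : forall p q, p <= q -> {linear V p -> V q}) : Prop :=
  (forall p (pp : p <= p) v, phi p p pp v = v) /\
  (forall p q r (pq : p <= q) (qr : q <= r) (pr : p <= r) v,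
     phi p r pr v = phi q r qr (phi p q pq v)).

(* Functors to all vector spaces; infinite direct sums live here. *)
Record pmodule := PModule {
  pobj :> P -> lmodType F;
  pmap : forall p q, p <= q -> {linear pobj p -> pobj q};
  pmap_laws : functor_laws pmap }.

(* Functors to finite-dimensional vector spaces. *)
Record vmodule := VModule {
  vobj : P -> vectType F;
  vmap : forall p q, p <= q -> {linear vobj p -> vobj q};
  vmap_laws : @functor_laws (fun p => vobj p) vmap }.

Definition pmodule_of_vmodule (N : vmodule) : pmodule :=
  @PModule (fun p => vobj N p) (@vmap N) (vmap_laws N).

Definition pmodule_iso (M N : pmodule) : Prop :=
  exists phi : forall p, {linear M p -> N p},
    (forall p, bijective (phi p)) /\
    (forall p q (pq : p <= q) v, phi q (pmap M pq v) = pmap N pq (phi p v)).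

Definition poset_interval (J : set P) : Prop :=
  [/\ exists p, J p,
      forall a b c, J a -> J b -> a <= c -> c <= b -> J c &
      forall a b, J a -> J b ->
        exists s : seq P, [/\ path (fun x y => x >=< y) a s, last a s = b &
                              forall c, c \in s -> J c]].

End Modules.

Arguments pmap {F d P} _ {p q}.
Arguments vmap {F d P} _ {p q}.
Coercion pmodule_of_vmodule : vmodule >-> pmodule.

(** ** Interval modules *)

Section IntervalModule.
Variables (F : fieldType) (d : Order.disp_t) (P : porderType d) (J : set P).

(* The space F on J and the zero subspace of F elsewhere. *)
Definition interval_space (p : P) : {vspace F^o} :=
  if p \in J then fullv else 0%VS.

Definition interval_obj (p : P) : vectType F := subvs_of (interval_space p).

(* vsproj is the identity of F when q is in J, and is zero otherwise. *)
Definition interval_map (p q : P) (_ : (p <= q)%O) :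
    {linear interval_obj p -> interval_obj q} :=
  (vsproj (interval_space q) \o @vsval _ _ (interval_space p)).

Lemma interval_obj0 p (v : interval_obj p) : p \notin J -> v = 0.
Proof.
move=> /negPf pJ; apply/val_inj/eqP; rewrite linear0 -memv0.
have sub0 : (interval_space p <= 0)%VS by rewrite /interval_space pJ.
exact: (subvP sub0 _ (subvsP v)).
Qed.

Lemma interval_map_laws (hJ : poset_interval J) :
  @functor_laws F d P (fun p => interval_obj p) interval_map.
Proof.
have [_ cvx _] := hJ; split=> [p pp v|p q r pq qr pr v]; first exact: vsvalK.
have [rJ|rJ] := boolP (r \in J); last by rewrite [LHS]interval_obj0 // [RHS]interval_obj0.
have [pJ|pJ] := boolP (p \in J); last by rewrite (interval_obj0 v pJ) !linear0.
have qJ : q \in J.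
  by move: pJ rJ; rewrite !in_setE => pJ rJ; apply: cvx pq qr.
by rewrite /= [in RHS]vsprojK // /interval_space qJ memvf.
Qed.

Definition interval_module (hJ : poset_interval J) : vmodule F P :=
  VModule (interval_map_laws hJ).

End IntervalModule.

(** ** Direct sums of arbitrary families *)

Section DirectSumSpace.
Variables (F : fieldType) (I : Type) (V : I -> lmodType F).

Record dsum := DSum {
  dval : forall i, V i;
  dsum_finite : finite_set [set i | dval i <> 0] }.

HB.instance Definition _ := gen_eqMixin dsum.
HB.instance Definition _ := gen_choiceMixin dsum.

Lemma dsum_eqP (v w : dsum) : (forall i, dval v i = dval w i) -> v = w.
Proof.
case: v w => [v hv] [w hw] /= vw.
have {}vw : v = w by apply: functional_extensionality_dep.
by case: _ / vw hw => hw; congr DSum; apply: Prop_irrelevance.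
Qed.

Fact dsum0_subproof : finite_set [set i : I | (0 : V i) <> 0].
Proof. by apply: (sub_finite_set _ (@finite_set0 I)) => i /=. Qed.
Definition dsum0 : dsum := @DSum (fun i => 0) dsum0_subproof.

Fact dsumD_subproof (v w : dsum) :
  finite_set [set i : I | dval v i + dval w i <> 0].
Proof.
have hvw : finite_set
    ([set i | dval v i <> 0] `|` [set i | dval w i <> 0])%classic.
  by rewrite finite_setU; split; [exact: (dsum_finite v)|exact: (dsum_finite w)].
apply: (sub_finite_set _ hvw) => i /= vw.
have [vi|] := pselect (dval v i = 0); last by left.
by right=> wi; apply: vw; rewrite vi wi addr0.
Qed.
Definition dsumD (v w : dsum) : dsum := DSum (dsumD_subproof v w).

Fact dsumZ_subproof a (v : dsum) :
  finite_set [set i : I | a *: dval v i <> 0].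
Proof.
apply: (sub_finite_set _ (dsum_finite v)) => i /= avi vi.
by apply: avi; rewrite vi scaler0.
Qed.
Definition dsumZ a (v : dsum) : dsum := DSum (dsumZ_subproof a v).

Fact dsumN_subproof (v : dsum) : finite_set [set i : I | - dval v i <> 0].
Proof.
apply: (sub_finite_set _ (dsum_finite v)) => i /= avi vi.
by apply: avi; rewrite vi oppr0.
Qed.
Definition dsumN (v : dsum) : dsum := DSum (dsumN_subproof v).

Fact dsumA : associative dsumD.
Proof. by move=> u v w; apply: dsum_eqP => i /=; rewrite addrA. Qed.
Fact dsumC : commutative dsumD.
Proof. by move=> u v; apply: dsum_eqP => i /=; rewrite addrC. Qed.
Fact dsum0D : left_id dsum0 dsumD.
Proof. by move=> u; apply: dsum_eqP => i /=; rewrite add0r. Qed.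
Fact dsumND : left_inverse dsum0 dsumN dsumD.
Proof. by move=> u; apply: dsum_eqP => i /=; rewrite addNr. Qed.

HB.instance Definition _ := GRing.isZmodule.Build dsum dsumA dsumC dsum0D dsumND.

Fact dsumZA a b v : dsumZ a (dsumZ b v) = dsumZ (a * b) v.
Proof. by apply: dsum_eqP => i /=; rewrite scalerA. Qed.
Fact dsum1Z : left_id 1 dsumZ.
Proof. by move=> u; apply: dsum_eqP => i /=; rewrite scale1r. Qed.
Fact dsumZDr : right_distributive dsumZ +%R.
Proof. by move=> a u v; apply: dsum_eqP => i /=; rewrite scalerDr. Qed.
Fact dsumZDl v : {morph dsumZ^~ v : a b / a + b}.
Proof. by move=> a b; apply: dsum_eqP => i /=; rewrite scalerDl. Qed.

HB.instance Definition _ := GRing.Zmodule_isLmodule.Build F dsum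
  dsumZA dsum1Z dsumZDr dsumZDl.

End DirectSumSpace.

Section DirectSumMap.
Variables (F : fieldType) (I : Type) (V W : I -> lmodType F).
Variable f : forall i, {linear V i -> W i}.

Fact dsum_map_subproof (v : dsum V) : finite_set [set i | f i (dval v i) <> 0].
Proof.
apply: (sub_finite_set _ (dsum_finite v)) => i /= fvi vi.
by apply: fvi; rewrite vi linear0.
Qed.
Definition dsum_map (v : dsum V) : dsum W := DSum (dsum_map_subproof v).

Fact dsum_map_linear : linear dsum_map.
Proof. by move=> a u v; apply: dsum_eqP => i /=; rewrite linearP. Qed.

HB.instance Definition _ := GRing.isLinear.Build F (dsum V) (dsum W) _
  dsum_map dsum_map_linear.

End DirectSumMap.

Section DirectSum.
Variables (F : fieldType) (d : Order.disp_t) (P : porderType d).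
Variables (I : Type) (M : I -> pmodule F P).

Definition dsum_pmap (p q : P) (pq : (p <= q)%O) :
    {linear dsum (fun i => M i p) -> dsum (fun i => M i q)} :=
  dsum_map (fun i => pmap (M i) pq).

Lemma dsum_pmap_laws :
  @functor_laws F d P (fun p => dsum (fun i => M i p)) dsum_pmap.
Proof.
split=> [p pp v|p q r pq qr pr v]; apply: dsum_eqP => i /=.
  exact: (pmap_laws (M i)).1.
exact: (pmap_laws (M i)).2.
Qed.

Definition dsum_pmodule : pmodule F P := PModule dsum_pmap_laws.

End DirectSum.

(** ** Barcodes *)

Section Barcodes.
Variables (F : fieldType) (d : Order.disp_t) (P : porderType d).

(* A multiset of subsets of P is given as an indexed family, whose indexing
   type is immaterial. *)
Definition is_barcode (N : vmodule F P) (I : Type) (J : I -> set P) : Prop :=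
  exists hJ : forall i, poset_interval (J i),
    pmodule_iso N (dsum_pmodule (fun i => interval_module F (hJ i))).

Definition interval_decomposable (N : vmodule F P) : Prop :=
  exists (I : Type) (J : I -> set P), is_barcode N J.

End Barcodes.

(** * Simplicial homology *)

Record scomplex (X : finType) := SComplex {
  simplices :> {set {set X}};
  simplex_neq0 : finset.set0 \notin simplices;
  simplex_face : forall A B : {set X},
    A \in simplices -> B \subset A -> B != finset.set0 -> B \in simplices }.

Section Homology.
Variables (F : fieldType) (X : finType).
Implicit Types (K L : scomplex X) (n : nat).

(* All chain spaces sit in the space with basis the subsets of X; a simplex is
   oriented by the order of enum X. *)
Definition chain_space : vectType F := {ffun {set X} -> F^o}.

Definition basis_chain (A : {set X}) : chain_space :=
  [ffun B => (B == A)%:R : F^o].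

(* The boundary of a vertex is 0: homology is not reduced. *)
Definition boundary_simplex (A : {set X}) : chain_space :=
  if (1 < #|A|)%N then
    \sum_(a in A)
      (-1) ^+ #|[set b in A | (enum_rank b < enum_rank a)%N]|
        *: basis_chain (A :\ a)
  else 0.

Definition boundary_fun (c : chain_space) : chain_space :=
  \sum_A c A *: boundary_simplex A.

Fact boundary_fun_linear : linear boundary_fun.
Proof.
move=> a c e; rewrite /boundary_fun scaler_sumr -big_split /=.
by apply: eq_bigr => A _; rewrite !ffunE scalerDl scalerA.
Qed.
HB.instance Definition _ := GRing.isLinear.Build F chain_space chain_space _
  boundary_fun boundary_fun_linear.

Definition boundary : 'End(chain_space) := linfun boundary_fun.

Definition chains K n : {vspace chain_space} :=
  <<[seq basis_chain A | A : {set X} <- enum (simplices K) & #|A| == n.+1]>>%VS.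

Definition cycles K n : {vspace chain_space} :=
  (chains K n :&: lker boundary)%VS.

Definition boundaries K n : {vspace chain_space} :=
  (boundary @: chains K n.+1)%VS.

(* The boundaries as a subspace of the space of cycles. *)
Definition cycle_boundaries K n : {vspace subvs_of (cycles K n)} :=
  (linfun (@vsval _ _ (cycles K n)) @^-1: boundaries K n)%VS.

Definition homology K n : vectType F := vquot (cycle_boundaries K n).

Section Functoriality.
Variables (K L : scomplex X) (n : nat).
Hypothesis KL : simplices K \subset simplices L.

Lemma chainsS m : (chains K m <= chains L m)%VS.
Proof.
apply: sub_span => c /mapP[A]; rewrite mem_filter mem_enum => /andP[Am AK] ->.
by apply: map_f; rewrite mem_filter mem_enum Am (fintype.subsetP KL).
Qed.

Lemma cyclesS : (cycles K n <= cycles L n)%VS.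
Proof. by rewrite capvS ?chainsS. Qed.

(* As cyclesS holds, vsproj acts here as the inclusion. *)
Definition cycle_incl :
    {linear subvs_of (cycles K n) -> subvs_of (cycles L n)} :=
  (vsproj (cycles L n) \o @vsval _ _ (cycles K n)).

Lemma cycle_inclE z : vsval (cycle_incl z) = vsval z.
Proof. by rewrite /= vsprojK // (subvP cyclesS) ?subvsP. Qed.

Lemma cycle_incl_boundaries z :
  z \in cycle_boundaries K n -> cycle_incl z \in cycle_boundaries L n.
Proof.
rewrite /cycle_boundaries -!memv_preim !lfunE => zK.
rewrite [X in X \in _](cycle_inclE z); move: zK.
have KLb : (boundaries K n <= boundaries L n)%VS by rewrite limgS ?chainsS.
exact: (subvP KLb).
Qed.

Definition homology_map : {linear homology K n -> homology L n} :=
  vquot_map cycle_incl_boundaries.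

End Functoriality.

End Homology.

Record filtration (d : Order.disp_t) (P : porderType d) (X : finType) :=
  Filtration {
    fcomplex :> P -> scomplex X;
    fcomplex_mono : forall p q, (p <= q)%O ->
      simplices (fcomplex p) \subset simplices (fcomplex q) }.

Section HomologyModule.
Variables (F : fieldType) (d : Order.disp_t) (P : porderType d) (X : finType).
Variables (K : filtration P X) (n : nat).

Definition homology_pmap (p q : P) (pq : (p <= q)%O) :
    {linear homology F (K p) n -> homology F (K q) n} :=
  homology_map F n (fcomplex_mono K pq).

Lemma homology_pmap_laws :
  @functor_laws F d P (fun p => homology F (K p) n) homology_pmap.
Proof.
split=> [p pp v|p q r pq qr pr v]; rewrite -(vquot_reprK v) /=.
  rewrite vquot_mapE; congr vquot_pi; apply: val_inj.
  exact: (cycle_inclE (fcomplex_mono K pp)).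
rewrite !vquot_mapE; congr vquot_pi; apply: val_inj.
apply: etrans (cycle_inclE (fcomplex_mono K pr) _) _; apply: esym.
apply: etrans (cycle_inclE (fcomplex_mono K qr) _) _.
exact: (cycle_inclE (fcomplex_mono K pq)).
Qed.

Definition homology_module : vmodule F P := VModule homology_pmap_laws.

End HomologyModule.

(** * Augmented metric spaces *)

Record aug_metric (R : realType) := AugMetric {
  carrier :> finType;
  dist : carrier -> carrier -> R;
  dist_ge0 : forall x y, 0 <= dist x y;
  dist_eq0 : forall x y, dist x y = 0 <-> x = y;
  dist_sym : forall x y, dist x y = dist y x;
  dist_triangle : forall x y z, dist x z <= dist x y + dist y z;
  aug : carrier -> R }.

Section RipsBifiltration.
Variables (R : realType) (X : aug_metric R).
Implicit Types (S A : {set X}) (s e : R).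

Definition sublevel s : {set X} := [set x | aug x <= s].

Definition rips_simplices S e : {set {set X}} :=
  [set A : {set X} | [&& A != finset.set0, A \subset S &
     [forall a in A, forall b in A, dist a b <= e]]].

Lemma rips_neq0 S e : finset.set0 \notin rips_simplices S e.
Proof. by rewrite inE eqxx. Qed.

Lemma rips_face S e (A B : {set X}) :
  A \in rips_simplices S e -> B \subset A -> B != finset.set0 ->
  B \in rips_simplices S e.
Proof.
rewrite !inE => /and3P[_ AS /forall_inP dA] BA ->.
rewrite (fintype.subset_trans BA AS) /=; apply/forall_inP => a aB.
apply/forall_inP => b bB.
by have /forall_inP := dA a (fintype.subsetP BA _ aB); apply; apply: (fintype.subsetP BA).
Qed.

Definition rips S e : scomplex X := SComplex (rips_neq0 S e) (@rips_face S e).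

Lemma rips_mono (p q : R *p R) : (p <= q)%O ->
  simplices (rips (sublevel p.1) p.2) \subset
  simplices (rips (sublevel q.1) q.2).
Proof.
case: p q => [s e] [s' e'] /andP[/= ss' ee']; apply/fintype.subsetP => A.
rewrite !inE => /and3P[-> AS /forall_inP dA] /=; apply/andP; split.
  apply: (fintype.subset_trans AS); apply/fintype.subsetP => x; rewrite !inE => xs.
  exact: le_trans xs ss'.
apply/forall_inP => a aA; apply/forall_inP => b bA.
by have /forall_inP /(_ b bA) := dA a aA => /le_trans; apply.
Qed.

Definition rips_bifiltration : filtration (R *p R)%type X :=
  @Filtration _ (R *p R)%type X
    (fun p => rips (sublevel p.1) p.2) rips_mono.

(** ** Elder-rule-staircode and conquerors *)

(* x and y, assumed in S, are joined in S by a sequence of steps of length at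
   most e. *)
Definition joined S e : rel X :=
  connect (fun a b => [&& a \in S, b \in S & dist a b <= e]).

Definition block s e (x : X) : {set X} :=
  [set y in sublevel s | joined (sublevel s) e x y].

Definition strict_total_order (lt : rel X) : Prop :=
  [/\ irreflexive lt, transitive lt & forall x y, x != y -> lt x y || lt y x].

Definition compatible (lt : rel X) : Prop :=
  forall x y, aug x < aug y -> lt x y.

Definition is_min (lt : rel X) A (x : X) : Prop :=
  x \in A /\ forall y, y \in A -> y != x -> lt x y.

Definition staircode (lt : rel X) (x : X) : set (R *p R)%type :=
  [set p | [/\ 0 <= p.2, x \in sublevel p.1 & is_min lt (block p.1 p.2 x) x]].

(* The infimum is a minimum for x and y in S, see link_scale_min. *)
Definition link_scale S (x y : X) : R :=
  inf [set e | 0 <= e /\ joined S e x y].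

Lemma joined_trans_scale S e e' x y : e <= e' ->
  joined S e x y -> joined S e' x y.
Proof.
move=> ee'; apply: connect_sub => a b /and3P[aS bS ab].
by apply: connect1; rewrite aS bS (le_trans ab).
Qed.

Lemma link_scale_min S x y : x \in S -> y \in S ->
  [/\ 0 <= link_scale S x y, joined S (link_scale S x y) x y &
      forall e, 0 <= e -> joined S e x y -> link_scale S x y <= e].
Proof.
move=> xS yS; have dxx z : dist z z = 0 :> R by apply/dist_eq0.
pose D (p : X * X) := dist p.1 p.2.
have jxy : joined S (D (x, y)) x y.
  by apply: connect1; rewrite xS yS lexx.
case: (@arg_minP _ _ _ (x, y) (fun p => joined S (D p) x y) D jxy).
move=> m jm mmin.
have mle e : 0 <= e -> joined S e x y -> D m <= e.
  move=> e0 je; have xe : D (x, x) <= e by rewrite /D dxx.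
  case: (@arg_maxP _ _ _ (x, x) (fun p => D p <= e) D xe) => k ke kmax.
  apply: le_trans ke; apply: mmin; apply: connect_sub je => a b.
  move=> /and3P[aS bS ab]; apply: connect1; rewrite aS bS.
  exact: (kmax (a, b)).
have m0 : 0 <= D m by apply: dist_ge0.
suff -> : link_scale S x y = D m by split.
apply/eqP; rewrite eq_le; apply/andP; split.
  by apply: ge_inf; [exists 0 => e [] | split].
by apply: lb_le_inf; [exists (D m) | move=> e [e0 je]; apply: mle].
Qed.

(* z is a conqueror of y in the subspace S, for the restriction of lt. *)
Definition conqueror (lt : rel X) S (y z : X) : Prop :=
  [/\ y \in S, z \in S, lt z y &
      forall w, w \in S -> lt w y -> link_scale S y z <= link_scale S y w].

Definition conqueror_function (lt : rel X) (x : X)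
    (c : {s : R | aug x <= s} -> X) : Prop :=
  (is_min lt [set: X] x -> forall t, c t = x) /\
  (~ is_min lt [set: X] x ->
     forall t, conqueror lt (sublevel (sval t)) x (c t)).

End RipsBifiltration.

Definition constant_function (A B : Type) (f : A -> B) : Prop :=
  exists b, forall a, f a = b.

(* Main.v *)
From HB Require Import structures.
Require Import Defs.
From mathcomp Require Import all_boot all_order all_algebra reals.
From mathcomp Require Import boolp classical_sets cardinality.

(* Iterating the constant conqueror function c from a vertex y gives a chain of
   ancestors y, c y, c (c y), ... ending at the minimum of X. In degree 0 the
   class of y telescopes as the sum of the relative classes [x] - [c x] over its
   ancestors x (the last one being just [x]). At a parameter p outside the
   staircode of x, the constant conqueror lies in the block of x, so the relative
   class of x vanishes; hence sending y to the indicator of its ancestors whose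
   staircode contains p is well defined on homology, with inverse sending the
   generator of the x-th bar to [x] - [c x]. Since c does not depend on p, this
   is natural in p. *)

Set Implicit Arguments.
Unset Strict Implicit.
Unset Printing Implicit Defensive.

Import Order.TTheory GRing.Theory Num.Theory.

Local Open Scope ring_scope.

(** * Linear maps out of quotients and into direct sums *)

Section LinearAlgebra.
Variable F : fieldType.

Lemma span_ind (V : vectType F) (X : seq V) (P : V -> Prop) :
  P 0 -> (forall a u v, P u -> P v -> P (a *: u + v)) ->
  (forall v, v \in X -> P v) -> forall v, v \in <<X>>%VS -> P v.
Proof.
move=> P0 PD PX v /(@coord_span _ _ _ (in_tuple X)) ->.
elim/big_rec: _ => // i u _ Pu; apply: PD => //; apply: PX.
by rewrite mem_nth.
Qed.

(** A sigma type, so that the lifts at all parameters form one family of linear maps. *)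
Lemma vquot_lift (V : vectType F) (U : {vspace V}) (W : lmodType F)
    (f : {linear V -> W}) :
  (forall u, u \in U -> f u = 0) ->
  {g : {linear vquot U -> W} | forall v, g (vquot_pi U v) = f v}.
Proof.
move=> fU; pose g (x : vquot U) := f (vquot_repr x).
have g_pi v : g (vquot_pi U v) = f v.
  by apply/eqP; rewrite -subr_eq0 -linearB fU ?vquot_repr_pi.
have g_linear : linear g.
  move=> a x y; rewrite -(vquot_reprK x) -(vquot_reprK y) -linearP.
  by rewrite !g_pi linearP.
pose gL := GRing.isLinear.Build F (vquot U) W _ g g_linear.
by exists (HB.pack_for {linear vquot U -> W} g gL).
Qed.

(** Finiteness of [I] makes every tuple of values finitely supported. *)
Lemma dsum_tuple (V : lmodType F) (I : finType) (W : I -> lmodType F)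
    (f : forall i, {linear V -> W i}) :
  {g : {linear V -> dsum W} | forall v i, dval (g v) i = f i v}.
Proof.
pose g v : dsum W := @DSum _ _ _ (fun i => f i v) finite_finset.
have g_linear : linear g.
  by move=> a u v; apply: dsum_eqP => i /=; rewrite linearP.
pose gL := GRing.isLinear.Build F V (dsum W) _ g g_linear.
by exists (HB.pack_for {linear V -> dsum W} g gL).
Qed.

End LinearAlgebra.

(** * Generators of cycles and boundaries in degree 0 *)

Section DegreeZero.
Variables (F : fieldType) (X : finType).
Implicit Types (K : scomplex X) (z : chain_space F X) (w : X -> F).

Definition vertex (a : X) : chain_space F X := basis_chain F [set a].

Lemma boundary_basis (A : {set X}) :
  boundary F X (basis_chain F A) = boundary_simplex F A.
Proof.
rewrite lfunE /= /boundary_fun (bigD1 A) //= big1 => [|B /negPf BA].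
  by rewrite ffunE eqxx scale1r addr0.
by rewrite ffunE BA scale0r.
Qed.

Lemma boundary_vertex a : boundary F X (vertex a) = 0.
Proof. by rewrite boundary_basis /boundary_simplex cards1. Qed.

(** The sign depends on how [enum_rank] orders [a] and [b]; spans do not see it, so it is left as
    some power of -1. *)
Lemma boundary_edge a b : a != b -> exists n : nat,
  boundary F X (basis_chain F [set a; b]) = (-1) ^+ n *: (vertex a - vertex b).
Proof.
wlog ab : a b / (enum_rank a < enum_rank b)%N => [wl ab|].
  have := ab; rewrite -(inj_eq enum_rank_inj) -val_eqE neq_ltn.
  case/orP=> lt_ab; first exact: wl.
  have [|n e] := wl b a lt_ab; first by rewrite eq_sym.
  exists n.+1; rewrite finset.setUC e -opprB.
  by rewrite exprS mulN1r scaleNr scalerN.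
move=> nab; have nba : b != a by rewrite eq_sym.
(* With [a] before [b], deleting [a] gives [+[b]] and deleting [b] gives [-[a]]: the opposite of the
   stated difference. *)
exists 1; rewrite boundary_basis /boundary_simplex cards2 nab /=.
rewrite big_setU1 ?inE //= big_set1.
have -> : [set a; b] :\ a = [set b].
  by apply/setP => x; rewrite !inE; case: (eqVneq x a) => // ->; rewrite (negPf nab).
have -> : [set a; b] :\ b = [set a].
  by apply/setP => x; rewrite !inE; case: (eqVneq x b) => [->|]; rewrite ?orbF ?(negPf nba).
have -> : [set x in [set a; b] | (enum_rank x < enum_rank a)%N] = finset.set0.
  apply/setP => x; rewrite !inE; case: eqVneq => [->|_] /=; first exact: ltnn.
  by case: eqVneq => [->|] //=; rewrite ltnNge ltnW.
have -> : [set x in [set a; b] | (enum_rank x < enum_rank b)%N] = [set a].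
  apply/setP => x; rewrite !inE; case: eqVneq => [->|_] //=.
  by case: eqVneq => [->|] //=; rewrite ltnn.
by rewrite cards0 cards1 expr0 expr1 scale1r scalerBr !scaleN1r opprK addrC.
Qed.

Lemma vertex_cycle K a : [set a] \in simplices K -> vertex a \in cycles F K 0.
Proof.
move=> aK; rewrite memv_cap memv_ker boundary_vertex eqxx andbT.
by apply: memv_span; apply: map_f; rewrite mem_filter mem_enum cards1 eqxx.
Qed.

Lemma cycles0_ind K (P : chain_space F X -> Prop) :
  P 0 -> (forall k u v, P u -> P v -> P (k *: u + v)) ->
  (forall a, [set a] \in simplices K -> P (vertex a)) ->
  forall z, z \in cycles F K 0 -> P z.
Proof.
move=> P0 PD Pv z; rewrite memv_cap => /andP[zK _]; move: zK.
apply: span_ind => // v /mapP[A]; rewrite mem_filter mem_enum => /andP[].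
by case/cards1P=> a -> aK ->; apply: Pv.
Qed.

(** The case [a = b] is included so that paths with repeated vertices telescope without
    exception. *)
Lemma edge_boundary K a b : [set a; b] \in simplices K ->
  vertex a - vertex b \in boundaries F K 0.
Proof.
have [->|ab abK] := eqVneq a b; first by rewrite subrr mem0v.
have [n e] := boundary_edge ab.
rewrite -[vertex a - _](signrZK n) -e rpredZ // memv_img //.
by apply: memv_span; apply: map_f; rewrite mem_filter mem_enum cards2 ab.
Qed.

Lemma boundaries0_ind K (P : chain_space F X -> Prop) :
  P 0 -> (forall k u v, P u -> P v -> P (k *: u + v)) ->
  (forall a b, [set a; b] \in simplices K -> P (vertex a - vertex b)) ->
  forall z, z \in boundaries F K 0 -> P z.
Proof.
move=> P0 PD Pe z /memv_imgP[c cK ->]; move: c cK.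
apply: span_ind => [|k u v Pu Pv|c]; first by rewrite linear0.
  by rewrite linearP; apply: PD.
case/mapP=> A; rewrite mem_filter mem_enum => /andP[/cards2P[a [b [ab ->]]] abK ->].
have [n ->] := boundary_edge ab.
(* Adding 0 gives the signed difference the form [k *: u + v] under which [P] is closed. *)
by rewrite -[X in P X]addr0; apply: PD => //; apply: Pe.
Qed.

(** Defined on the ambient chain space, so that one functional serves the complexes at all
    parameters. *)
Definition vertex_sum w z : F^o := \sum_a z [set a] * w a.

Fact vertex_sum_linear w : linear (vertex_sum w).
Proof.
move=> k u v; rewrite /vertex_sum scaler_sumr -big_split /=.
by apply: eq_bigr => a _; rewrite !ffunE mulrDl -mulrA.
Qed.
HB.instance Definition _ w := GRing.isLinear.Build F (chain_space F X) F^o _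
  (vertex_sum w) (vertex_sum_linear w).

Lemma vertex_sum_vertex w a : vertex_sum w (vertex a) = w a.
Proof.
rewrite /vertex_sum (bigD1 a) //= big1 => [|b ba].
  by rewrite ffunE eqxx mul1r addr0.
by rewrite ffunE (inj_eq set1_inj) (negPf ba) mul0r.
Qed.

End DegreeZero.

(** * Staircodes as intervals, and conquerors *)

Section Staircode.
Variables (R : realType) (X : aug_metric R) (lt : rel X).
Implicit Types (p q : (R *p R)%type) (x y : X).

Lemma joined_mono (S S' : {set X}) (e e' : R) x y : S \subset S' -> e <= e' ->
  joined S e x y -> joined S' e' x y.
Proof.
move=> SS' ee'; apply: connect_sub => a b /and3P[aS bS ab].
by apply: connect1; rewrite !(fintype.subsetP SS') //= (le_trans ab).
Qed.

Lemma joined_sym (S : {set X}) (e : R) : connect_sym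
  (fun a b : X => [&& a \in S, b \in S & dist a b <= e]).
Proof. by apply: sym_connect_sym => a b; rewrite andbCA dist_sym. Qed.

Lemma sublevel_mono (s t : R) : s <= t -> sublevel X s \subset sublevel X t.
Proof.
by move=> st; apply/fintype.subsetP => x; rewrite !inE => /le_trans; apply.
Qed.

(** Blocks shrink as the parameter decreases, so the minimum of a block stays minimal. *)
Lemma staircode_lower x p q : (p <= q)%O -> staircode lt x q ->
  0 <= p.2 -> x \in sublevel X p.1 -> staircode lt x p.
Proof.
case: p q => [s e] [s' e'] /andP[/= ss' ee'] [/= e'0 xs' [_ xmin]] e0 xs.
split=> //; split=> [|y]; first by rewrite inE xs /joined connect0.
rewrite inE => /andP[ys xy]; apply: xmin.
by rewrite inE (fintype.subsetP (sublevel_mono ss')) //= (joined_mono _ ee' xy) ?sublevel_mono.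
Qed.

(** At scale 0 a path can only repeat its starting point, so the block of [x] is a singleton. *)
Lemma staircode_birth x : staircode lt x (aug x, 0).
Proof.
split; rewrite /= ?inE ?lexx //; split; first by rewrite !inE lexx /joined connect0.
move=> y; rewrite inE => /andP[_ /connectP[s]] /=; move: (sublevel X _) => S.
elim: s x => [|z s IHs] x /=; first by move=> _ ->; rewrite eqxx.
case/andP=> /and3P[_ _ xz]; suff -> : z = x by apply: IHs.
by apply/esym/dist_eq0/eqP; rewrite eq_le xz dist_ge0.
Qed.

(** [(aug x, 0)] is the least element of the staircode, so any two points are linked through it. *)
Lemma staircode_interval x : poset_interval (staircode lt x).
Proof.
split; first by exists (aug x, 0); apply: staircode_birth.
  move=> a b q [a0 xa _] xb aq qb; apply: staircode_lower qb xb _ _.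
    by apply: le_trans a0 _; case/andP: aq.
  by case/andP: aq => /sublevel_mono/fintype.subsetP sub _; apply: sub.
have birth_le a : staircode lt x a -> ((aug x, 0) <= a :> (R *p R)%type)%O.
  by case: a => s e [/= e0]; rewrite inE => xs _; apply/andP.
move=> a b xa xb; exists [:: (aug x, 0); b]; split=> //=.
  by rewrite /Order.comparable birth_le // orbT birth_le.
by move=> q; rewrite !inE => /orP[] /eqP -> //; apply: staircode_birth.
Qed.

Hypothesis lt_total : strict_total_order lt.

Lemma lt_asym x y : lt x y -> lt y x -> False.
Proof.
have [irr tr _] := lt_total.
by move=> xy yx; have := tr _ _ _ xy yx; rewrite irr.
Qed.

(** Since [X] is finite, one can induct on the number of predecessors. *)
Lemma lt_ind (P : X -> Prop) :
  (forall x, (forall y, lt y x -> P y) -> P x) -> forall x, P x.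
Proof.
have [irr tr _] := lt_total => IH x.
have [n le_n] := ubnP #|[set y | lt y x]|; elim: n x le_n => // n IHn x le_n.
apply: IH => y yx; apply: IHn; rewrite ltnS in le_n.
apply: leq_trans le_n; apply: proper_card; apply/fintype.properP; split.
  by apply/fintype.subsetP => z; rewrite !inE => /tr; apply.
by exists y; rewrite !inE ?irr.
Qed.

(** Each of the two would be the minimum of a block containing the other. *)
Lemma staircode_block_inj p x y : staircode lt x p -> staircode lt y p ->
  joined (sublevel X p.1) p.2 x y -> x = y.
Proof.
move=> [_ xp [_ xmin]] [_ yp [_ ymin]] xy; apply: contrapT => /eqP nxy.
apply: (@lt_asym x y).
  by apply: xmin; rewrite 1?eq_sym // inE yp.
by apply: ymin; rewrite // inE xp /joined joined_sym.
Qed.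

Hypothesis lt_compat : compatible lt.

Lemma aug_le_of_lt x y : lt x y -> aug x <= aug y.
Proof. by rewrite leNgt => xy; apply/negP => /lt_compat /(lt_asym xy). Qed.

(* At the minimum of X, c x = x; the second clause is what remains of minimality. *)
Definition conquers (c : X -> X) : Prop := forall x,
  [/\ c x != x -> lt (c x) x,
      c x = x -> forall p, 0 <= p.2 -> x \in sublevel X p.1 -> staircode lt x p &
      forall p, 0 <= p.2 -> x \in sublevel X p.1 -> ~ staircode lt x p ->
        joined (sublevel X p.1) p.2 x (c x)].

Lemma conquers_exists :
  (forall x : X, exists c : {s : R | (aug x <= s)%R} -> X,
     conqueror_function lt c /\ constant_function c) ->
  exists c, conquers c.
Proof.
have [irr _ tot] := lt_total.
have min_staircode x p : is_min lt [set: X] x -> 0 <= p.2 ->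
    x \in sublevel X p.1 -> staircode lt x p.
  move=> [_ xmin] p0 xp; split=> //; split; first by rewrite inE xp /joined connect0.
  by move=> y _; apply: xmin; rewrite inE.
move=> const_conq.
suff /choice[c cP] : forall x, exists y, [/\ y != x -> lt y x,
      y = x -> forall p, 0 <= p.2 -> x \in sublevel X p.1 -> staircode lt x p &
      forall p, 0 <= p.2 -> x \in sublevel X p.1 -> ~ staircode lt x p ->
        joined (sublevel X p.1) p.2 x y] by exists c.
move=> x; have [f [[fmin fconq] [b fb]]] := const_conq x.
exists b; have [xmin|xnmin] := pselect (is_min lt [set: X] x).
  (* The domain of [f] contains [aug x], so the constant value [b] is attained there. *)
  have -> : b = x by rewrite -(fb (exist _ (aug x) (lexx _))) fmin.
  split=> [/eqP //|_ p p0 xp|p p0 xp]; first exact: min_staircode.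
  by case; apply: min_staircode.
have bconq s (xs : aug x <= s) : conqueror lt (sublevel X s) x b.
  by rewrite -(fb (exist _ s xs)); apply: (fconq xnmin (exist _ s xs)).
have lt_bx : lt b x by have [] := bconq _ (lexx _).
split=> // [bx|p p0 xp xnp]; first by rewrite bx irr in lt_bx.
have xs : aug x <= p.1 by rewrite inE in xp.
have [_ bp _ bmin] := bconq _ xs.
(* Without such a [y], the point [x] would be the minimum of its block and [p] would lie in its
   staircode. *)
have [y [yp xy lt_yx]] : exists y,
    [/\ y \in sublevel X p.1, joined (sublevel X p.1) p.2 x y & lt y x].
  apply: contrapT => nex; apply: xnp; split=> //.
  split=> [|y]; first by rewrite inE xp /joined connect0.
  rewrite inE => /andP[yp xy] /tot /orP[lt_yx|//]; case: nex; by exists y.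
(* The conqueror [b] is linked to [x] no later than its competitor [y], hence at a scale at most
   [p.2]. *)
have [_ jb _] := link_scale_min xp bp.
have [_ _ ymin] := link_scale_min xp yp.
by apply: joined_trans_scale jb; apply: le_trans (bmin _ yp lt_yx) (ymin _ p0 xy).
Qed.

(** * Ancestor chains of a conqueror map *)

Variable c : X -> X.
Hypothesis cP : conquers c.

Lemma conquers_aug x : aug (c x) <= aug x.
Proof.
have [->|ncx] := eqVneq (c x) x; first exact: lexx.
by apply: aug_le_of_lt; have [/(_ ncx)] := cP x.
Qed.

Lemma fconnect_aug x y : fconnect c x y -> aug y <= aug x.
Proof.
case/connectP => s + ->; elim: s x => [|z s IHs] x /=; first by rewrite lexx.
by case/andP=> /eqP <- /IHs /le_trans; apply; apply: conquers_aug.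
Qed.

Lemma fconnect_eq_or_lt x y : fconnect c x y -> y = x \/ lt y x.
Proof.
have [_ tr _] := lt_total.
case/connectP => s + ->; elim: s x => [|z s IHs] x /=; first by left.
case/andP=> /eqP <- /IHs.
have [e|ncx] := eqVneq (c x) x; first by rewrite e.
have [/(_ ncx) lt_cx _ _] := cP x.
by case=> [->|lt_l]; right => //; apply: tr lt_l lt_cx.
Qed.

(** Away from its fixed points [c] strictly decreases, so its orbits never return. *)
Lemma fconnect_conquers_self x : fconnect c (c x) x -> c x = x.
Proof.
have [//|ncx] := eqVneq (c x) x; have [/(_ ncx) lt_cx _ _] := cP x.
case/fconnect_eq_or_lt => [e|lt_xc]; first by rewrite -e eqxx in ncx.
by case: (lt_asym lt_cx lt_xc).
Qed.

(** Follow the chain of [x] until it first meets an [r] whose staircode contains [p]. Every element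
    before [r] steps to a conqueror in the same block, and, its own staircode missing [p], is none
    of the [y] considered. *)
Lemma block_elder p x : 0 <= p.2 -> x \in sublevel X p.1 -> exists r,
  [/\ staircode lt r p, joined (sublevel X p.1) p.2 x r &
      forall y, staircode lt y p -> fconnect c x y = fconnect c r y].
Proof.
move=> p0; elim/lt_ind: x => x IHx xp.
have [Jx|nJx] := pselect (staircode lt x p).
  by exists x; split=> //; apply: connect0.
have [lt_cx fix_x /(_ p p0 xp nJx) x_cx] := cP x.
have ncx : c x != x by apply/eqP => /fix_x /(_ p p0 xp).
have cxp : c x \in sublevel X p.1.
  by move: xp; rewrite !inE; apply: le_trans (conquers_aug x).
have [r [Jr cx_r rP]] := IHx _ (lt_cx ncx) cxp.
exists r; split=> // [|y Jy]; first exact: connect_trans x_cx cx_r.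
rewrite fconnect_eqVf -(rP y Jy); case: eqP => // xy.
by rewrite xy in nJx.
Qed.

(** The elders found from [x] and from [y] lie in one block, hence coincide. This makes the ancestor
    indicators constant along edges. *)
Lemma fconnect_joined p x y z : 0 <= p.2 -> x \in sublevel X p.1 ->
  y \in sublevel X p.1 -> joined (sublevel X p.1) p.2 x y ->
  staircode lt z p -> fconnect c x z = fconnect c y z.
Proof.
move=> p0 xp yp xy Jz.
have [r [Jr x_r rP]] := block_elder p0 xp.
have [r' [Jr' y_r' rP']] := block_elder p0 yp.
suff e : r = r' by rewrite rP // e rP'.
apply: staircode_block_inj Jr Jr' _; apply: connect_trans y_r'.
by apply: connect_trans xy; rewrite joined_sym.
Qed.

End Staircode.

Lemma interval_projE (F : fieldType) (d : Order.disp_t) (P : porderType d) (J : set P) (p : P)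
    (k : F^o) :
  @vsval _ _ (interval_space F J p) (vsproj _ k) = if p \in J then k else 0.
Proof.
have [pJ|pJ] := ifP; first by rewrite vsprojK // /interval_space pJ memvf.
have -> : vsproj (interval_space F J p) k = 0.
  exact: (@interval_obj0 _ _ _ J p _ (negbT pJ)).
exact: linear0.
Qed.

(** * Duality between ancestor functionals and relative classes *)

Section Decomposition.
Variables (F : fieldType) (R : realType) (X : aug_metric R) (lt : rel X).
Hypotheses (lt_total : strict_total_order lt) (lt_compat : compatible lt).
Variable c : X -> X.
Hypothesis cP : conquers lt c.
Implicit Types (p q : (R *p R)%type) (x y : X) (z : chain_space F X).

(** The sign condition comes from the pair [x], [x], at distance 0. *)
Lemma rips_vertex p x :
  ([set x] \in simplices (rips_bifiltration X p)) =
  (0 <= p.2) && (x \in sublevel X p.1).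
Proof.
rewrite inE -card_gt0 cards1 finset.sub1set [RHS]andbC /=; congr (_ && _).
have dxx : dist x x = 0 :> R by apply/dist_eq0.
apply/forall_inP/idP => [xx|p0 a].
  by have := forall_inP (xx x (set11 x)) x (set11 x); rewrite dxx.
by move=> /set1P ->; apply/forall_inP => b /set1P ->; rewrite dxx.
Qed.

Lemma rips_edge p x y :
  ([set x; y] \in simplices (rips_bifiltration X p)) =
  [&& x \in sublevel X p.1, y \in sublevel X p.1 & dist x y <= p.2].
Proof.
rewrite inE finset.subUset !finset.sub1set -andbA -card_gt0 cards2 /=.
congr [&& _, _ & _].
apply/forall_inP/idP => [xy|dxy a].
  exact: forall_inP (xy x (set21 x y)) y (set22 x y).
have p0 : 0 <= p.2 by apply: le_trans dxy; apply: dist_ge0.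
have dvv v : dist v v = 0 :> R by apply/dist_eq0.
by case/set2P => ->; apply/forall_inP => b /set2P[] ->; rewrite ?dvv // dist_sym.
Qed.

(** The difference telescopes along the path, each step being an edge of the Rips complex. *)
Lemma joined_boundary p x y : joined (sublevel X p.1) p.2 x y ->
  vertex F x - vertex F y \in boundaries F (rips_bifiltration X p) 0.
Proof.
case/connectP => s + ->; elim: s x => [|v s IHs] x /=.
  by rewrite subrr mem0v.
case/andP; rewrite -rips_edge => /(edge_boundary F) xv /IHs vs.
by rewrite -(subrKA (vertex F v)) rpredD.
Qed.

Lemma fconnect_fixed x y : c x = x -> fconnect c x y = (x == y).
Proof.
move=> cx; apply/connectP/eqP => [[s + ->]|->]; last by exists [::].
by elim: s => //= v s IHs /andP[/eqP <-]; rewrite cx.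
Qed.

(** The argument order makes [ancestor x] a weight on vertices for [vertex_sum]: the indicator of
    the descendants of [x]. *)
Definition ancestor x y : F := (fconnect c y x)%:R.

(** Without the case split, a fixed point of [c] would yield 0 instead of a generator of its bar. *)
Definition relative_vertex x : chain_space F X :=
  vertex F x - (if c x == x then 0 else vertex F (c x)).

(** The chain of [y] is [y] followed by the chain of [c y], so only the contribution of [y] survives
    in the difference. *)
Lemma ancestor_relative_vertex x y :
  vertex_sum (ancestor x) (relative_vertex y) = (y == x)%:R.
Proof.
rewrite /relative_vertex linearB /= vertex_sum_vertex /ancestor fconnect_eqVf.
have [cy|ncy] := eqVneq (c y) y.
  by rewrite linear0 subr0 cy fconnect_fixed // orbb.
rewrite vertex_sum_vertex /ancestor; case: eqVneq => [<-|_] /=.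
  (* Here [c y] differs from [y], so [y] cannot recur among the ancestors of [c y]. *)
  have [e|] := boolP (fconnect c (c y) y); last by rewrite subr0.
  by rewrite (fconnect_conquers_self lt_total cP e) eqxx in ncy.
by rewrite subrr.
Qed.

Lemma sum_ancestor_relative_vertex y :
  \sum_x ancestor x y *: relative_vertex x = vertex F y.
Proof.
elim/(lt_ind lt_total): y => y IHy.
have [cy|ncy] := eqVneq (c y) y.
  rewrite (bigD1 y) //= big1 => [|x xy].
    by rewrite addr0 /ancestor connect0 scale1r /relative_vertex cy eqxx subr0.
  by rewrite /ancestor fconnect_fixed // eq_sym (negPf xy) scale0r.
have [/(_ ncy) lt_cy _ _] := cP y.
(* Split off the first element of the chain of [y]; the identity between the coefficients is read
   off from the duality lemma. *)
rewrite (eq_bigr (fun x => (y == x)%:R *: relative_vertex x +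
    ancestor x (c y) *: relative_vertex x)) => [|x _]; last first.
  rewrite -scalerDl -(ancestor_relative_vertex x y); congr (_ *: _).
  by rewrite /relative_vertex (negPf ncy) linearB /= !vertex_sum_vertex subrK.
rewrite big_split /= IHy // (bigD1 y) //= big1 => [|x xy]; last first.
  by rewrite eq_sym (negPf xy) scale0r.
by rewrite eqxx scale1r addr0 /relative_vertex (negPf ncy) subrK.
Qed.

Lemma relative_vertex_cycle p x : staircode lt x p ->
  relative_vertex x \in cycles F (rips_bifiltration X p) 0.
Proof.
case=> p0 xp _; rewrite rpredB ?vertex_cycle ?rips_vertex ?p0 //.
case: ifP => _; rewrite ?mem0v // vertex_cycle ?rips_vertex ?p0 //=.
by move: xp; rewrite !inE; apply: le_trans (conquers_aug lt_total lt_compat cP x).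
Qed.

(** On a vertex, the subtraction cancels the terms of the telescoping sum whose staircode contains
    [p]. Each remaining ancestor [x] is joined to [c x] at [p], so its relative vertex is a
    boundary. *)
Lemma sub_sum_relative_vertex p z :
  z \in cycles F (rips_bifiltration X p) 0 ->
  z - \sum_x (if p \in staircode lt x then vertex_sum (ancestor x) z else 0)
        *: relative_vertex x \in boundaries F (rips_bifiltration X p) 0.
Proof.
move: z; apply: cycles0_ind => [|k u v Pu Pv|y].
- rewrite big1 ?subr0 ?mem0v // => x _.
  by rewrite linear0 if_same scale0r.
- rewrite (_ : _ - _ = k *: (u - \sum_x (if p \in staircode lt x then
      vertex_sum (ancestor x) u else 0) *: relative_vertex x) +
      (v - \sum_x (if p \in staircode lt x then
      vertex_sum (ancestor x) v else 0) *: relative_vertex x)).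
    by rewrite rpredD // rpredZ.
  rewrite scalerBr addrACA -opprD; congr (_ - _).
  rewrite scaler_sumr -big_split /=; apply: eq_bigr => x _.
  case: ifP => _; last by rewrite !scale0r scaler0 addr0.
  by rewrite linearP /= scalerDl scalerA.
rewrite rips_vertex => /andP[p0 yp].
rewrite -[X in X - _](sum_ancestor_relative_vertex y) -sumrB rpred_sum // => x _.
rewrite vertex_sum_vertex -scalerBl; case: ifPn => [_|/negP xp].
  by rewrite subrr scale0r mem0v.
rewrite subr0 /ancestor; have [yx|_] := boolP (fconnect c y x); last first.
  by rewrite scale0r mem0v.
have xs : x \in sublevel X p.1.
  by move: yp; rewrite !inE; apply: le_trans (fconnect_aug lt_total lt_compat cP yx).
have {}xp : ~ staircode lt x p by move=> Jx; apply: xp; rewrite in_setE.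
have [_ fix_x /(_ p p0 xs xp) x_cx] := cP x.
rewrite scale1r /relative_vertex; case: eqP => [/fix_x /(_ p p0 xs) //|_].
exact: joined_boundary.
Qed.

Lemma vertex_sum_boundary p x z : staircode lt x p ->
  z \in boundaries F (rips_bifiltration X p) 0 ->
  vertex_sum (ancestor x) z = 0.
Proof.
move=> Jx; move: z; apply: boundaries0_ind => [|k u v u0 v0|a b].
- exact: linear0.
- by rewrite linearP /= u0 v0 scaler0 addr0.
rewrite rips_edge => /and3P[ap bp ab]; rewrite linearB /= !vertex_sum_vertex.
have p0 : 0 <= p.2 by case: Jx.
rewrite /ancestor (fconnect_joined lt_total lt_compat cP p0 ap bp _ Jx) ?subrr //.
by apply: connect1; rewrite ap bp.
Qed.

(** Ancestors of a vertex present at [p] are born no later than that vertex. The premise is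
    conditional because the complex is empty at negative scales. *)
Lemma vertex_sum_unborn p x z : (0 <= p.2 -> p.1 < aug x) ->
  z \in cycles F (rips_bifiltration X p) 0 -> vertex_sum (ancestor x) z = 0.
Proof.
move=> px; move: z; apply: cycles0_ind => [|k u v u0 v0|a].
- exact: linear0.
- by rewrite linearP /= u0 v0 scaler0 addr0.
rewrite rips_vertex inE vertex_sum_vertex => /andP[/px {}px ap].
rewrite /ancestor; case: (boolP (fconnect c a x)) => // ax.
have := fconnect_aug lt_total lt_compat cP ax.
by rewrite leNgt (le_lt_trans ap px).
Qed.

End Decomposition.

(** * The isomorphism with the sum of interval modules *)

Theorem theorem4p10 (F : fieldType) (R : realType) (X : aug_metric R)
    (lt : rel X)
    (lt_total : strict_total_order lt)
    (lt_compat : compatible lt)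
    (const_conq : forall x : X, exists c : {s : R | (aug x <= s)%R} -> X,
       conqueror_function lt c /\ constant_function c) :
  interval_decomposable (homology_module F (rips_bifiltration X) 0) /\
  is_barcode (homology_module F (rips_bifiltration X) 0) (staircode lt).
Proof.
suff bar : is_barcode (homology_module F (rips_bifiltration X) 0) (staircode lt).
  by split=> //; exists X, (staircode lt).
have [c cP] := conquers_exists lt_total const_conq.
exists (staircode_interval lt).
pose K := rips_bifiltration X; pose J := staircode lt.
(* The coordinate along the bar of [x]; [vsproj] sets it to 0 when [p] is outside the bar. *)
pose f p x : {linear subvs_of (cycles F (K p) 0) -> interval_obj F (J x) p} :=
  (vsproj (interval_space F (J x) p) \o vertex_sum (ancestor F c x)
    \o @vsval _ _ (cycles F (K p) 0)).
have f_val p x z : vsval (f p x z) =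
    if p \in J x then vertex_sum (ancestor F c x) (vsval z) else 0.
  exact: interval_projE.
pose g p := sval (dsum_tuple (f p)).
have gE p z x : dval (g p z) x = f p x z by apply: (svalP (dsum_tuple (f p))).
have g0 p z : z \in cycle_boundaries F (K p) 0 -> g p z = 0.
  rewrite /cycle_boundaries -memv_preim lfunE => /= zb.
  apply: dsum_eqP => x; rewrite gE; apply: val_inj.
  rewrite [LHS]f_val [RHS]linear0; case: ifP => //; rewrite in_setE => Jx.
  exact: vertex_sum_boundary Jx zb.
pose phi p := sval (vquot_lift (g0 p)).
have phiE p z : phi p (vquot_pi _ z) = g p z.
  exact: (svalP (vquot_lift (g0 p))).
exists phi; split=> [p|p q pq v].
  pose E (v : dsum (fun x => interval_obj F (J x) p)) : chain_space F X :=
    \sum_x vsval (dval v x) *: relative_vertex F c x.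
  have E_cycle v : E v \in cycles F (K p) 0.
    rewrite rpred_sum // => x _; have [px|px] := boolP (p \in J x).
      by rewrite rpredZ // (relative_vertex_cycle F lt_total lt_compat cP) // -in_setE.
    by rewrite (interval_obj0 (dval v x) px) linear0 scale0r mem0v.
  exists (fun v => vquot_pi (cycle_boundaries F (K p) 0)
                     (vsproj (cycles F (K p) 0) (E v))) => [v|v].
    (* From homology and back: the representative changes only by a boundary. *)
    rewrite -(vquot_reprK v) phiE; set z := vquot_repr v.
    apply/esym/vquot_eqP; rewrite /cycle_boundaries -memv_preim lfunE.
    rewrite [X in X \in _](linearB (@vsval _ _ (cycles F (K p) 0))) /=.
    rewrite vsprojK // /E.
    under eq_bigr do rewrite gE f_val.
    by apply: (sub_sum_relative_vertex lt_total lt_compat cP); apply: subvsP.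
  (* From the direct sum and back: duality extracts each coefficient. *)
  rewrite phiE; apply: dsum_eqP => x; rewrite gE; apply: val_inj.
  rewrite [LHS]f_val vsprojK //; case: ifPn => [px|px]; last first.
    by rewrite (interval_obj0 (dval v x) px) linear0.
  rewrite /E linear_sum (bigD1 x) //= big1 => [|y yx].
    by rewrite linearZ /= (ancestor_relative_vertex F lt_total cP) eqxx addr0 [LHS]mulr1.
  by rewrite linearZ /= (ancestor_relative_vertex F lt_total cP) (negPf yx) [LHS]mulr0.
rewrite -(vquot_reprK v); set z := vquot_repr v.
rewrite /= vquot_mapE !phiE; apply: dsum_eqP => x; rewrite gE.
apply: val_inj; rewrite [LHS]f_val (cycle_inclE (rips_mono X pq)).
apply: etrans (esym (interval_projE (J x) q (vsval (dval (g p z) x)))).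
case: ifP => //; rewrite in_setE gE f_val; case: ifPn => // /negP px qx.
(* What remains of naturality is the case of [q] in the bar of [x] and [p] outside it. By
   [staircode_lower], either [p.2] is negative or [x] is not yet born at [p], so the coordinate is
   0. *)
apply: (vertex_sum_unborn lt_total lt_compat cP) (subvsP z) => p0.
rewrite ltNge; apply/negP => xp; apply: px; rewrite in_setE.
by apply: staircode_lower pq qx p0 _; rewrite inE.
Qed.
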